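(* Let $\Sigma$ be a self-converse oriented graph on $n$ vertices with walk-matrix $W(\Sigma)$. Suppose that the Smith normal form of $W(\Sigma)$ is $$\mathrm{diag}(\underbrace{1,1,\ldots,1}_{\lceil n/2\rceil},\underbrace{2,2,\ldots,2,2d}_{\lfloor n/2\rfloor}),$$ i.e. the first $\lceil n/2\rceil$ diagonal entries equal $1$, the next $\lfloor n/2\rfloor-1$ entries equal $2$, and the last entry equals $2d$, where $d$ is any odd integer (not necessarily square-free). Then $\Sigma$ is determined by its generalized skew spectrum (DGSS).
   Context: An oriented graph $\Sigma$ on vertex set $\{v_1,\dots,v_n\}$ is a simple graph in which every edge has been given a direction. Its skew adjacency matrix $S=S(\Sigma)=(S_{ij})$ is the $n\times n$ matrix with $S_{ij}=1$ if $(v_i,v_j)$ is a (directed) edge, $S_{ij}=-1$ if $(v_j,v_i)$ is an edge, and $S_{ij}=0$ otherwise; thus $S^{\mathrm T}=-S$. The walk-matrix of $\Sigma$ is $W(\Sigma)=[e,Se,S^2e,\ldots,S^{n-1}e]$, where $e$ is the all-ones vector. The converse $\Sigma^{\mathrm T}$ is obtained by reversing every edge; $\Sigma$ is self-converse if it is isomorphic to $\Sigma^{\mathrm T}$, equivalently if there is a permutation matrix $P$ with $P^{\mathrm T}SP=S^{\mathrm T}=-S$. $\Sigma$ is determined by its generalized skew spectrum (DGSS) if every oriented graph $\Delta$ with $\mathrm{Spec}(S(\Sigma))=\mathrm{Spec}(S(\Delta))$ and $\mathrm{Spec}(J-S(\Sigma))=\mathrm{Spec}(J-S(\Delta))$ (where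 $J$ is the all-ones matrix) is isomorphic to $\Sigma$. The Smith normal form of a nonsingular integer matrix $M$ is the unique diagonal matrix $\mathrm{diag}(d_1,\ldots,d_n)$ with positive integers $d_i\mid d_{i+1}$ such that $M=U_1\,\mathrm{diag}(d_1,\dots,d_n)\,U_2$ for some integer matrices $U_1,U_2$ of determinant $\pm1$. *)

(* Defs.v *)
From mathcomp Require Import all_boot all_order all_algebra all_fingroup.
Set Implicit Arguments. Unset Strict Implicit. Unset Printing Implicit Defensive.
Import GRing.Theory Num.Theory.
Local Open Scope ring_scope.

(* An oriented graph on vertex set 'I_n, given by its skew adjacency matrix:
   entries in {-1,0,1} and S^T = -S (so zero diagonal; S i j = 1 means (v_i,v_j)
   is an arc, S i j = -1 means (v_j,v_i) is an arc). *)
Definition oriented_skew (n : nat) (S : 'M[int]_n) : Prop :=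
  S^T = - S /\ (forall i j, S i j = 0 \/ S i j = 1 \/ S i j = -1).

Fixpoint mxpow (n : nat) (S : 'M[int]_n) (k : nat) : 'M[int]_n :=
  match k with
  | 0%N => 1%:M
  | k'.+1 => S *m mxpow S k'
  end.

Definition ones_col (n : nat) : 'cV[int]_n := const_mx 1.
Definition Jmx (n : nat) : 'M[int]_n := const_mx 1.

Definition walk_matrix (n : nat) (S : 'M[int]_n) : 'M[int]_n :=
  \matrix_(i < n, j < n) (mxpow S j *m ones_col n) i 0.

Definition skew_iso (n : nat) (S S' : 'M[int]_n) : Prop :=
  exists s : 'S_n, (perm_mx s)^T *m S *m perm_mx s = S'.

Definition self_converse (n : nat) (S : 'M[int]_n) : Prop := skew_iso S S^T.

(* equality of spectra of integer matrices = equality of characteristic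
   polynomials (the spectrum being the multiset of complex roots) *)
Definition same_spec (n : nat) (A B : 'M[int]_n) : Prop :=
  char_poly A = char_poly B.

Definition DGSS (n : nat) (S : 'M[int]_n) : Prop :=
  forall S' : 'M[int]_n, oriented_skew S' ->
    same_spec S S' -> same_spec (Jmx n - S) (Jmx n - S') ->
    skew_iso S S'.

Definition snf_target (n : nat) (d : int) : 'M[int]_n :=
  \matrix_(i < n, j < n)
    (if i == j then
       (if (i < n - n./2)%N then 1
        else if (i == n.-1 :> nat) then 2 * d else 2)
     else 0).

Definition has_SNF (n : nat) (M D : 'M[int]_n) : Prop :=
  exists U1 U2 : 'M[int]_n,
    (\det U1 = 1 \/ \det U1 = -1) /\ (\det U2 = 1 \/ \det U2 = -1) /\
    M = U1 *m D *m U2.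

(* Main.v *)
Require Import Defs.
From mathcomp Require Import all_boot all_order all_algebra all_fingroup.
From mathcomp Require Import ring.
Set Implicit Arguments.
Unset Strict Implicit.
Unset Printing Implicit Defensive.
Import Order.TTheory GRing.Theory Num.Theory.
Local Open Scope ring_scope.

(**
The two spectra determine all the walk counts e^T S^k e, so a graph with skew
adjacency matrix S' and the same generalized skew spectrum has S Q = Q S' and
Q e = e for the rational orthogonal matrix Q = W(S) W(S')^-1. If A = N Q is
integral and a prime p divides N, we show that p divides A; descending on N, Q
is integral, hence a permutation matrix. A column u of A satisfies
u^T S^k e = 0 mod p and |S^k u|^2 = 0 mod p^2 for all k. Let P be the
permutation matrix with P S = - S P, so that P W = W D with
D = diag(1, -1, 1, ...).

For p odd, W is invertible mod p unless p divides d, in which case the left and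
right kernels of W mod p are lines, spanned by b and a. If u <> 0 mod p then b
is isotropic, b S = 0 and b P = mu b with mu = 1 or -1, and the integral matrix
2 d W^-1, which is a b mod p, gives D a = mu a. Since b is isotropic,
b^T = g(S) e for some polynomial g, which may be chosen so that X g is a
multiple of the polynomial a(X); hence g(-X) = - mu g and P b^T = - mu b^T, a
contradiction.

For p = 2, comparing traces shows that P has at most one fixed point, and then
every P-invariant integer vector z satisfies d z = f(S^2) e for some integer
polynomial f. This gives u = g(S) e mod 2, then g(S)^2 e = 0 mod 2 from the
congruences mod 4, and finally u = 0 mod 2 because the vectors S^(2i) e span
the same space mod 2 as the vectors S^i e.
*)

(** * Walk counts from characteristic polynomials *)

(** Matrix determinant lemma, read off two factorizations of one bordered matrix; the second brings
    in an extra factor [\det M], which is cancelled at the end. *)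
Lemma det_sub_rank1 (R : idomainType) n (M : 'M[R]_n) (u : 'cV[R]_n)
    (v : 'rV[R]_n) :
  \det M != 0 -> \det (M - u *m v) = \det M - (v *m \adj M *m u) 0 0.
Proof.
move=> dM0.
have E1 : block_mx M u v 1%:M
    = block_mx (M - u *m v) u 0 1%:M *m block_mx 1%:M 0 v (1%:M : 'M_1).
  rewrite mulmx_block !mulmx1 !mul0mx !mulmx0 !mul1mx !add0r ?addr0.
  by rewrite subrK.
have E2 : block_mx M u v 1%:M *m block_mx 1%:M (- (\adj M *m u)) 0 (\det M)%:M
    = block_mx M 0 v ((\det M)%:M - v *m \adj M *m u).
  rewrite mulmx_block !mulmx1 !mulmx0 !addr0 !mulmxN mul1mx mulmxA mul_mx_adj.
  by rewrite mul_scalar_mx mul_mx_scalar addNr mulmxA addrC.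
have := congr1 determinant E2; rewrite det_mulmx {1}E1 det_mulmx.
rewrite !det_ublock !det_lblock !det1 !mulr1 !mul1r det_scalar expr1.
rewrite [\det (_ - v *m _ *m _)]det_mx11 !mxE eqxx mulr1n mulrC.
by move/(mulfI dM0).
Qed.

Lemma size_det_linear (R : idomainType) n (M : 'M[{poly R}]_n) :
  (forall i j, (size (M i j) <= 2)%N) -> (size (\det M) <= n.+1)%N.
Proof.
move=> sM; apply: (leq_trans (size_sum _ _ _)).
apply/bigmax_leqP => s _; rewrite mulr_sign.
have H : (size (\prod_i M i (s i))%R <= n.+1)%N.
  apply: (leq_trans (size_poly_prod_leq _ _)).
  rewrite (eq_card (B := 'I_n)) // card_ord.
  rewrite leq_subLR addnS ltnS addnn -muln2.
  rewrite -[X in (_ <= X * _)%N]card_ord -sum_nat_const.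
  exact: leq_sum.
by case: ifP => // _; rewrite size_polyN.
Qed.

Lemma size_adj_char_poly_mx (R : idomainType) n (T : 'M[R]_n.+1) i j :
  (size (\adj (char_poly_mx T) i j) <= n.+1)%N.
Proof.
rewrite mxE /cofactor -signr_odd mulr_sign.
have H : (size (\det (row' j (col' i (char_poly_mx T)))) <= n.+1)%N.
  apply: size_det_linear => k l; rewrite !mxE.
  apply: leq_trans (size_polyD _ _) _; rewrite geq_max size_polyN.
  rewrite (leq_trans (size_polyC_leq1 _)) // andbT.
  by case: eqP => _; rewrite ?mulr1n ?mulr0n ?size_polyX ?size_poly0.
by case: ifP => // _; rewrite size_polyN.
Qed.

(* With N := k + 1, the identity below exhibits sum_(i < N) (v T^i u) X^(N-1-i)
   as the quotient of X^N (v adj(X - T) u) by the monic polynomial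
   char_poly T, and v adj(X - T) u is char_poly T - char_poly (T + u v). *)
Lemma moments_char_poly (R : idomainType) n (T T' : 'M[R]_n.+1)
    (u : 'cV[R]_n.+1) (v : 'rV[R]_n.+1) :
  char_poly T = char_poly T' ->
  char_poly (T + u *m v) = char_poly (T' + u *m v) ->
  forall k, v *m T ^+ k *m u = v *m T' ^+ k *m u.
Proof.
move=> eqT eqTJ k.
pose pC m m' (A : 'M[R]_(m, m')) := map_mx (@polyC R) A.
pose a A := (pC _ _ v *m \adj (char_poly_mx A) *m pC _ _ u) 0 0.
pose c A i := (v *m A ^+ i *m u) 0 0.
pose q A := \sum_(i < k.+1) 'X^(k - i) * (c A i)%:P.
pose r A := (pC _ _ v *m \adj (char_poly_mx A) *m pC _ _ (A ^+ k.+1 *m u)) 0 0.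
have aE A : a A = char_poly A - char_poly (A + u *m v).
  rewrite {2}/char_poly /char_poly_mx map_mxD map_mxM opprD addrA.
  rewrite -/(char_poly_mx A) det_sub_rank1 -/(char_poly A).
    by rewrite opprB addrC subrK.
  by rewrite monic_neq0 // char_poly_monic.
(* Factor X^(k+1) - A^(k+1) through X - A; the adjugate turns the factor X - A into
   [char_poly A]. *)
have key A : 'X^(k.+1) * a A - r A = q A * char_poly A.
  have cXA : GRing.comm ('X%:M : 'M[{poly R}]_n.+1) (pC _ _ A).
    by rewrite /GRing.comm -!mulmxE scalar_mxC.
  have pCX i : pC _ _ A ^+ i = pC _ _ (A ^+ i).
    elim: i => [|i IHi]; first by rewrite !expr0 [RHS]map_mx1.
    by rewrite !exprS IHi [RHS]map_mxM.
  have := congr1 (fun M => pC _ _ v *m (\adj (char_poly_mx A) *m M) *m pC _ _ u)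
    (subrXX_comm k.+1 cXA).
  rewrite -/(char_poly_mx A) -mulmxE mulmxA mul_adj_mx.
  rewrite mulmxBr mulmxBr mulmxBl -rmorphXn /= pCX.
  rewrite mul_mx_scalar -scalemxAr -scalemxAl => /matrixP/(_ 0 0).
  rewrite mxE [X in X + _ = _]mxE -/(a A) [X in _ + X = _]mxE.
  have -> : (pC _ _ v *m (\adj (char_poly_mx A) *m pC _ _ (A ^+ k.+1))
      *m pC _ _ u) 0 0 = r A by rewrite /r [in RHS]/pC map_mxM !mulmxA.
  move=> ->; rewrite -/(char_poly A) mul_scalar_mx -scalemxAr -scalemxAl mxE.
  rewrite mulrC.
  congr (_ * _); rewrite mulmx_sumr mulmx_suml summxE; apply: eq_bigr => i _.
  rewrite pCX -rmorphXn /= mul_scalar_mx -scalemxAr -scalemxAl mxE.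
  by rewrite -/pC -map_mxM -map_mxM mxE.
have sr A : (size (r A) <= n.+1)%N.
  rewrite /r mxE; apply: leq_trans (size_sum _ _ _) _; apply/bigmax_leqP => j _.
  rewrite [X in _ * X]mxE mulrC mul_polyC.
  apply: leq_trans (size_scale_leq _ _) _.
  rewrite mxE; apply: leq_trans (size_sum _ _ _) _; apply/bigmax_leqP => l _.
  rewrite [X in X * _]mxE mul_polyC; apply: leq_trans (size_scale_leq _ _) _.
  exact: size_adj_char_poly_mx.
have eqa : a T = a T' by rewrite !aE eqT eqTJ.
(* Uniqueness of division by a monic polynomial: the remainders [r] have degree at most n, below
   that of [char_poly T]. *)
have eqq : q T = q T'.
  apply/eqP; rewrite -subr_eq0; apply/negPn/negP => nz.
  have E : (q T - q T') * char_poly T = r T' - r T.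
    rewrite mulrBl {2}eqT -!key eqa opprB addrA.
    by rewrite [_ + r T']addrC addrA addrAC [r T' + _]addrC addrK.
  have : (size (r T' - r T)%R <= n.+1)%N.
    apply: leq_trans (size_polyD _ _) _; rewrite size_polyN geq_max.
    by apply/andP; split; apply: sr.
  rewrite -E size_Mmonic ?char_poly_monic // size_char_poly addnS /=.
  by rewrite -[X in (_ <= X)%N]add0n leq_add2r leqn0 size_poly_eq0 (negPf nz).
have q0 A : (q A)`_0 = c A k.
  rewrite coef_sum big_ord_recr /= subnn mul1r coefC eqxx big1 ?add0r // => i _.
  by rewrite coefXnM subn_gt0 ltn_ord.
apply/matrixP => i j; rewrite !ord1.
by have := congr1 (fun p : {poly R} => p`_0) eqq; rewrite /= !q0.
Qed.

(** * Krylov matrices and the odd primes *)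

(** The walk-matrix over any ring, so that it can be reduced mod p and also formed for [S ^+ 2]. *)
Definition krylov (R : nzRingType) n (S : 'M[R]_n.+1) (e : 'cV[R]_n.+1) :
    'M[R]_n.+1 :=
  \matrix_(i, j) (S ^+ j *m e) i 0.

Definition altsign_mx (R : nzRingType) n : 'M[R]_n :=
  diag_mx (\row_j (-1) ^+ j).

Lemma col_krylov (R : nzRingType) n (S : 'M[R]_n.+1) e (j : 'I_n.+1) :
  col j (krylov S e) = S ^+ j *m e.
Proof. by apply/colP => i; rewrite !mxE. Qed.

Lemma mul_krylov (R : nzRingType) m n (y : 'M[R]_(m, n.+1)) (S : 'M[R]_n.+1) e
    i j :
  (y *m krylov S e) i j = (y *m (S ^+ j *m e)) i 0.
Proof. by rewrite -col_krylov !mxE; apply: eq_bigr => k _; rewrite !mxE. Qed.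

Lemma krylovE (R : comNzRingType) n (S : 'M[R]_n.+1) e (x : 'cV_n.+1) :
  krylov S e *m x = horner_mx S (rVpoly x^T) *m e.
Proof.
rewrite /rVpoly poly_def rmorph_sum /= mulmx_suml.
apply/colP => i; rewrite summxE mxE; apply: eq_bigr => j _.
rewrite valK linearZ /= rmorphXn /= horner_mx_X -scalemxAl.
by rewrite [in RHS]mxE mulrC !mxE.
Qed.

Lemma altsign_mx_sqr (R : comNzRingType) n :
  altsign_mx R n *m altsign_mx R n = 1%:M.
Proof.
rewrite mulmx_diag; apply/matrixP => i j; rewrite !mxE -expr2 sqrr_sign.
by [].
Qed.

Lemma krylov_sum (R : comNzRingType) n (S : 'M[R]_n.+1) e (x : 'cV_n.+1) :
  krylov S e *m x = \sum_j x j 0 *: (S ^+ j *m e).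
Proof.
apply/colP => i; rewrite summxE mxE; apply: eq_bigr => j _.
by rewrite [RHS]mxE mulrC mxE.
Qed.

Lemma map_krylov (R R' : nzRingType) (f : {rmorphism R -> R'}) n
    (S : 'M[R]_n.+1) e :
  map_mx f (krylov S e) = krylov (map_mx f S) (map_mx f e).
Proof.
apply/matrixP => i j; rewrite !mxE rmorph_sum; apply: eq_bigr => k _.
by rewrite rmorphM -rmorphXn /= !mxE.
Qed.

Lemma coef_comp_polyNX (R : comNzRingType) (p : {poly R}) k :
  (p \Po (- 'X))`_k = (-1) ^+ k * p`_k.
Proof.
elim/poly_ind: p k => [|p c IHp] k; first by rewrite comp_poly0 coef0 mulr0.
rewrite comp_polyD comp_polyM comp_polyX comp_polyC mulrN !coefD coefN !coefMX.
rewrite !coefC; case: k => [|k] /=; first by rewrite oppr0 !add0r mul1r.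
by rewrite !addr0 IHp exprS mulN1r mulNr.
Qed.

Lemma skew_trmxX (R : comNzRingType) n (S : 'M[R]_n.+1) k :
  S^T = - S -> (S ^+ k)^T = (-1) ^+ k *: S ^+ k.
Proof.
move=> skS; elim: k => [|k IHk]; first by rewrite !expr0 scale1r trmx1.
rewrite exprSr -mulmxE trmx_mul IHk skS -scalemxAr mulNmx exprS mulN1r scaleNr.
by rewrite scalerN !mulmxE -exprS -exprSr.
Qed.

Section Anticommutation.

Variables (R : comNzRingType) (n : nat) (S P : 'M[R]_n.+1) (e : 'cV[R]_n.+1).
Hypotheses (PS : P *m S = - (S *m P)) (Pe : P *m e = e).

Lemma anticomm_mulX k : P *m (S ^+ k *m e) = (-1) ^+ k *: (S ^+ k *m e).
Proof.
elim: k => [|k IHk]; first by rewrite !expr0 scale1r mul1mx.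
rewrite exprS -mulmxE -mulmxA mulmxA PS mulNmx -mulmxA IHk -scalemxAr.
by rewrite exprS mulN1r scaleNr mulmxA.
Qed.

Lemma anticomm_krylov : P *m krylov S e = krylov S e *m altsign_mx R n.+1.
Proof.
apply/matrixP => i j; rewrite mul_krylov mul_mx_diag anticomm_mulX !mxE.
by rewrite mulrC.
Qed.

Lemma anticomm_horner p :
  P *m (horner_mx S p *m e) = horner_mx S (p \Po (- 'X)) *m e.
Proof.
rewrite -[p in LHS]coefK poly_def rmorph_sum /= comp_polyE rmorph_sum /=.
rewrite !mulmx_suml mulmx_sumr; apply: eq_bigr => i _.
rewrite !linearZ /= !rmorphXn /= rmorphN /= horner_mx_X -!scalemxAl -scalemxAr.
rewrite anticomm_mulX [(- S) ^+ _]exprNn -[in LHS]signr_odd scaler_sign.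
rewrite -[in RHS]signr_odd mulr_sign.
by case: odd; rewrite // mulNmx.
Qed.

End Anticommutation.


(** The case of an odd p dividing d, with z a column of A mod p. Up to the rank one projections
    [b' *m b] and [a *m a'], half of [E] inverts the Krylov matrix, so both of its kernels are
    lines. *)
Lemma isotropic_kernel_eq0 (F : fieldType) n (S P E : 'M[F]_n.+1)
    (e a b' z : 'cV[F]_n.+1) (a' b : 'rV[F]_n.+1) :
  (2%:R : F) != 0 -> S^T = - S -> P^T = P -> P *m P = 1%:M ->
  P *m S = - (S *m P) -> P *m e = e ->
  b *m b' = 1%:M -> a' *m a = 1%:M ->
  krylov S e *m E = 2%:R *: (1%:M - b' *m b) ->
  E *m krylov S e = 2%:R *: (1%:M - a *m a') ->
  krylov S e *m a = 0 ->
  b *m krylov S e = 0 ->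
  a *m b *m P = altsign_mx F n.+1 *m (a *m b) ->
  (forall k, z^T *m (S ^+ k *m e) = 0) -> z^T *m z = 0 -> z = 0.
Proof.
move=> nz2 skS symP PP PS Pe bb' a'a WE EW Wa bW abP zS zz.
set W := krylov S e in WE EW Wa bW.
have lker (y : 'rV_n.+1) : y *m W = 0 -> y = (y *m b') 0 0 *: b.
  move=> yW; have := congr1 (mulmx y) WE.
  rewrite mulmxA yW mul0mx -scalemxAr mulmxBr mulmx1 mulmxA => /esym/eqP.
  rewrite scaler_eq0 (negPf nz2) /= subr_eq0 => /eqP {1}->.
  by rewrite {1}[y *m b']mx11_scalar mul_scalar_mx.
(* The polynomials of degree at most n that annihilate e form the line spanned by the polynomial of
   [a]. *)
have rker (g : {poly F}) : (size g <= n.+1)%N -> horner_mx S g *m e = 0 ->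
    exists c, g = c *: rVpoly a^T.
  move=> sg; rewrite -(poly_rV_K sg) -[poly_rV g]trmxK -krylovE -/W.
  move: (poly_rV g)^T => y Wy; have := congr1 (mulmx^~ y) EW.
  rewrite /= -mulmxA Wy mulmx0 -scalemxAl mulmxBl mul1mx -mulmxA => /esym/eqP.
  rewrite scaler_eq0 (negPf nz2) /= subr_eq0 => /eqP yE.
  exists ((a' *m y) 0 0); rewrite -linearZ /= {1}yE {1}[a' *m y]mx11_scalar.
  by rewrite mul_mx_scalar linearZ.
apply/eqP/negPn/negP => nz_z.
have zW : z^T *m W = 0.
  by apply/rowP => j; rewrite mul_krylov zS !mxE.
set c := (z^T *m b') 0 0; have zE : z^T = c *: b by apply: lker.
have nz_c : c != 0.
  apply: contraNneq nz_z => c0; rewrite -[z]trmxK zE c0 scale0r trmx0 //.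
have bS k : b *m (S ^+ k *m e) = 0.
  have := zS k; rewrite zE -scalemxAl => /eqP.
  by rewrite scaler_eq0 (negPf nz_c) => /eqP.
have bbT : b *m b^T = 0.
  have := zz; rewrite -{2}[z]trmxK zE linearZ /= -scalemxAl -scalemxAr => /eqP.
  by rewrite !scaler_eq0 (negPf nz_c) => /eqP.
have nz_b : b != 0.
  apply/eqP => b0; have /matrixP/(_ 0 0)/eqP := bb'.
  by rewrite b0 mul0mx !mxE eq_sym oner_eq0.
have bSW : b *m S *m W = 0.
  apply/rowP => j; rewrite mul_krylov -mulmxA [S *m _]mulmxA.
  by rewrite -[S *m _]/(S * _) -exprS bS !mxE.
have bPW : b *m P *m W = 0.
  by rewrite -mulmxA /W anticomm_krylov // mulmxA -/W bW mul0mx.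
have := lker _ bSW; set la := (_ 0 0) => bSE.
have := lker _ bPW; set mu := (_ 0 0) => bPE.
have mu2 : mu * mu = 1.
  have : (mu * mu) *: b == 1 *: b.
    by rewrite scale1r -scalerA -bPE scalemxAl -bPE -mulmxA PP mulmx1.
  by rewrite -subr_eq0 -scalerBl scaler_eq0 (negPf nz_b) orbF subr_eq0 => /eqP.
have nz_mu : mu != 0.
  by apply/eqP => mu0; have /eqP := mu2; rewrite mu0 mul0r eq_sym oner_eq0.
(* Applying b to P S + S P = 0 gives 2 mu la b = 0. *)
have la0 : la = 0.
  have : b *m (P *m S) + b *m (S *m P) = 0 by rewrite PS mulmxN addNr.
  rewrite !mulmxA bPE -scalemxAl bSE -scalemxAl bPE !scalerA [la * _]mulrC.
  rewrite -mulr2n -scaler_nat scalerA => /eqP; rewrite scaler_eq0 (negPf nz_b).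
  by rewrite !mulf_eq0 (negPf nz2) (negPf nz_mu) orbF => /eqP.
have SbT : S *m b^T = 0.
  by apply/eqP; rewrite -oppr_eq0 -mulNmx -skS -trmx_mul bSE la0 scale0r trmx0.
have PbT : P *m b^T = mu *: b^T by rewrite -{1}symP -trmx_mul bPE linearZ.
have Da : altsign_mx F n.+1 *m a = mu *: a.
  have : a *m (b *m P) = altsign_mx F n.+1 *m a *m b.
    by rewrite mulmxA abP mulmxA.
  rewrite bPE -scalemxAr => /(congr1 (mulmx^~ b')) /=.
  by rewrite -scalemxAl -!mulmxA bb' !mulmx1.
set al := rVpoly a^T in rker.
have nz_a : a != 0.
  apply/eqP => a0; have /matrixP/(_ 0 0)/eqP := a'a.
  by rewrite a0 mulmx0 !mxE eq_sym oner_eq0.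
have nz_al : al != 0.
  apply: contraNneq nz_a => al0; rewrite -[a]trmxK -[a^T]rVpolyK -/al al0.
  by rewrite linear0 trmx0.
have s_al : (size al <= n.+1)%N by exact: size_poly.
have al_neg : al \Po (- 'X) = mu *: al.
  apply/polyP => k; rewrite coef_comp_polyNX coefZ coef_rVpoly.
  case: insubP => [j _ <-|_]; last by rewrite !mulr0.
  have /matrixP/(_ j 0) := Da; rewrite mul_diag_mx !mxE => <-.
  by [].
have evX g : horner_mx S ('X * g) *m e = S *m (horner_mx S g *m e).
  by rewrite rmorphM /= horner_mx_X mulmxA.
have ev_al : horner_mx S al *m e = 0 by rewrite -krylovE.
(* Otherwise X al would also have degree at most n and annihilate e, hence be a multiple of [al],
   which its degree forbids. *)
have al_full : size al = n.+1.
  apply/eqP; rewrite eqn_leq s_al /= leqNgt; apply/negP => lt_al.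
  have [||k alk] := rker ('X * al).
  - by rewrite mulrC size_mulX.
  - by rewrite evX ev_al mulmx0.
  have := congr1 (fun q : {poly F} => size q) alk.
  rewrite mulrC size_mulX // => sE.
  by have := size_scale_leq k al; rewrite -sE ltnn.
(* Isotropy of b makes E b^T / 2 a solution. Subtracting a multiple of [al] brings its degree below
   n, so that X g still falls under [rker]. *)
have [g sg gE] : exists2 g : {poly F},
    (size g <= n)%N & horner_mx S g *m e = b^T.
  pose g0 := rVpoly (2%:R^-1 *: (E *m b^T))^T.
  have g0E : horner_mx S g0 *m e = b^T.
    rewrite -krylovE -/W -scalemxAr mulmxA WE -scalemxAl scalerA mulVf //.
    by rewrite scale1r mulmxBl mul1mx -mulmxA bbT mulmx0 subr0.
  exists (g0 - (g0`_n / lead_coef al) *: al).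
    apply/leq_sizeP => j; rewrite leq_eqVlt => /predU1P[<-|lt_nj].
      rewrite coefB coefZ lead_coefE al_full /= divfK ?subrr //.
      by rewrite -[n]/(n.+1.-1) -al_full -lead_coefE lead_coef_eq0.
    have sg0 : (size g0 <= n.+1)%N by apply: size_poly.
    rewrite coefB coefZ ![_`_j]nth_default ?mulr0 ?subrr ?al_full //.
    exact: leq_trans sg0 lt_nj.
  by rewrite rmorphB /= linearZ /= mulmxBl -scalemxAl ev_al scaler0 subr0.
have [||k Xg] := rker ('X * g).
- rewrite mulrC (leq_trans (size_polyMleq _ _)) // size_polyX addn2 /=.
  by rewrite ltnS.
- by rewrite evX gE SbT.
have Xneg : ('X * g) \Po (- 'X) = mu *: ('X * g).
  by rewrite Xg comp_polyZ al_neg scalerA mulrC -scalerA.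
(* Cancelling the odd factor X reverses the sign. *)
have g_neg : g \Po (- 'X) = - mu *: g.
  move: Xneg; rewrite comp_polyM comp_polyX mulNr -mulrN scalerAr => /eqP.
  rewrite -subr_eq0 -mulrBr mulf_eq0 polyX_eq0 /= subr_eq0 => /eqP E1.
  by rewrite scaleNr -E1 opprK.
have : P *m b^T = - mu *: b^T.
  by rewrite -gE anticomm_horner // g_neg linearZ /= -scalemxAl.
move/eqP; rewrite PbT -subr_eq0 -scalerBl opprK -mulr2n scaler_eq0 -mulr_natl.
by rewrite mulf_eq0 (negPf nz2) (negPf nz_mu) /= trmx_eq0 (negPf nz_b).
Qed.

(** * The Smith normal form *)

Lemma det_pm1_unitmx n (U : 'M[int]_n) :
  \det U = 1 \/ \det U = -1 -> U \in unitmx.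
Proof. by rewrite unitmxE => -[] ->. Qed.

(* If W = U1 D U2 with D diagonal, then a, b' are the last columns of U2^-1, U1,
   and a', b the last rows of U2, U1^-1; E is U2^-1 G U1^-1 where G is diagonal
   and G D is twice the identity except for a last entry 0. *)
Lemma snf_target_decomp n (W : 'M[int]_n.+1) d :
  (0 < n)%N -> has_SNF W (snf_target n.+1 d) ->
  exists (E : 'M[int]_n.+1) (a b' : 'cV[int]_n.+1) (a' b : 'rV[int]_n.+1),
  [/\ (b *m b' = 1%:M) /\ (a' *m a = 1%:M),
      W *m E = 2%:R *: (1%:M - b' *m b),
      E *m W = 2%:R *: (1%:M - a *m a'),
      W *m a = (2%:R * d) *: b'
    & b *m W = (2%:R * d) *: a'].
Proof.
move=> n0 [U1 [U2 [/det_pm1_unitmx uU1 [/det_pm1_unitmx uU2 ->]]]].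
set D := snf_target _ _.
pose m := (n.+1 - n.+1./2)%N.
(* Thus the last diagonal entry is [2 * d] and not 1. *)
have lt_mn : (m <= n)%N by rewrite /m leq_subLR -[n.+1]add1n leq_add2r half_gt0.
pose G : 'M[int]_n.+1 :=
  diag_mx (\row_i if (i < m)%N then 2%:R else if i == ord_max then 0 else 1).
pose r : 'rV[int]_n.+1 := delta_mx 0 ord_max.
pose c : 'cV[int]_n.+1 := delta_mx ord_max 0.
have DE : D = diag_mx (\row_i if (i < m)%N then 1 else
                              if i == ord_max then 2%:R * d else 2%:R).
  apply/matrixP => i j; rewrite !mxE -/m.
  by case: (i =P j) => [->|_]; rewrite ?mulr1n ?mulr0n // -(inj_eq val_inj).
have crE : c *m r = delta_mx ord_max ord_max by rewrite mul_delta_mx.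
have rcE : r *m c = 1%:M.
  rewrite mul_delta_mx; apply/matrixP => i j; rewrite !ord1 !mxE //.
have DG : D *m G = 2%:R *: (1%:M - c *m r).
  rewrite crE DE mulmx_diag; apply/matrixP => i j; rewrite !mxE.
  have [->{i}|ij] := eqVneq i j; last first.
    rewrite mulr0n; case: (i =P ord_max) => [E1|_]; rewrite ?subrr ?mulr0 //.
    by rewrite eq_sym -E1 (negPf ij) subrr mulr0.
  rewrite !mulr1n andbb; have [->|nj] := eqVneq j ord_max.
    by rewrite ltnNge /= lt_mn /= mulr0 subrr mulr0.
  by case: ifP => _; rewrite subr0 ?mul1r ?mulr1.
have GD : G *m D = D *m G by rewrite DE; apply: diag_mxC.
have Dc : D *m c = (2%:R * d) *: c.
  apply/colP => i; rewrite DE mul_diag_mx !mxE eqxx andbT.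
  case: eqVneq => [->|_]; rewrite ?mulr0 // ltnNge /= lt_mn //.
have rD : r *m D = (2%:R * d) *: r.
  apply/rowP => i; rewrite DE mul_mx_diag !mxE eqxx /=.
  case: (i =P ord_max) => [->|_]; rewrite ?mulr0 ?mul0r // ltnNge /= lt_mn /=.
  by rewrite mul1r mulr1.
exists (invmx U2 *m G *m invmx U1), (invmx U2 *m c), (U1 *m c), (r *m U2),
  (r *m invmx U1); split; first split.
- by rewrite mulmxA mulmxKV.
- by rewrite mulmxA mulmxK.
- rewrite -!mulmxA [U2 *m _]mulmxA mulmxV // mul1mx [D *m _]mulmxA DG.
  rewrite -scalemxAl -scalemxAr mulmxBl mulmxBr mul1mx mulmxV //.
  by rewrite !mulmxA.
- rewrite -!mulmxA [invmx U1 *m _]mulmxA mulVmx // mul1mx [G *m _]mulmxA GD DG.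
  rewrite -scalemxAl -scalemxAr mulmxBl mulmxBr mul1mx mulVmx //.
  by rewrite !mulmxA.
- by rewrite mulmxA mulmxK // -mulmxA Dc scalemxAr.
- by rewrite !mulmxA mulmxKV // rD scalemxAl.
Qed.

(** * Parity *)

Lemma horner_mx_compXn (R : comNzRingType) n (S : 'M[R]_n.+1) m p :
  horner_mx S (p \Po 'X^m) = horner_mx (S ^+ m) p.
Proof.
elim/poly_ind: p => [|p c IHp]; first by rewrite comp_poly0 !rmorph0.
rewrite comp_polyD comp_polyM comp_polyX comp_polyC !rmorphD !rmorphM /= IHp.
by rewrite !horner_mx_C !horner_mx_X rmorphXn /= horner_mx_X.
Qed.

Lemma sqr_poly_F2 (p : {poly 'F_2}) : p ^+ 2 = p \Po 'X^2.
Proof.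
have add2 (q : {poly 'F_2}) : q *+ 2 = 0.
  by rewrite -mulr_natl pcharf0 ?mul0r // pchar_poly pchar_Fp.
elim/poly_ind: p => [|p c IHp]; first by rewrite comp_poly0 expr0n.
rewrite comp_polyD comp_polyM comp_polyX comp_polyC sqrrD add2 addr0 exprMn IHp.
congr (_ + _); rewrite -rmorphXn /=; congr (_%:P).
by case: c => -[|[|]] //= ?; apply: val_inj.
Qed.

(** With g the polynomial of x, g(S^2) = g(S)^2 by Frobenius, so g(S) e = 0 forces g(S^2) e = 0. *)
Lemma krylov_sqr_F2 n (S : 'M['F_2]_n.+1) e (x : 'cV_n.+1) :
  krylov S e *m x = 0 -> krylov (S ^+ 2) e *m x = 0.
Proof.
rewrite !krylovE => Sx0; rewrite -horner_mx_compXn -sqr_poly_F2 expr2.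
by rewrite [horner_mx S _]rmorphM /= -mulmxE -mulmxA Sx0 mulmx0.
Qed.

(** The factorization bounds the rank of A by that of B, and the inclusion of kernels gives the
    converse bound; kernels of equal dimension, one inside the other, coincide. *)
Lemma kermx_factor_eq (F : fieldType) m n p (A B : 'M[F]_(m, n)) (X : 'M[F]_n) :
  A = B *m X -> (forall x : 'cV_n, A *m x = 0 -> B *m x = 0) ->
  forall x : 'M_(n, p), B *m x = 0 -> A *m x = 0.
Proof.
move=> AE kAB x Bx.
have sub : (kermx A^T <= kermx B^T)%MS.
  apply/row_subP => i; apply/sub_kermxP; apply: trmx_inj.
  rewrite trmx_mul trmxK trmx0; apply: kAB; apply: trmx_inj.
  by rewrite trmx_mul trmxK trmx0; apply/sub_kermxP; apply: row_sub.
have rk : (\rank A <= \rank B)%N by rewrite AE mxrankM_maxl.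
have rkE : \rank (kermx A^T) == \rank (kermx B^T).
  by rewrite eqn_leq mxrankS //= !mxrank_ker !mxrank_tr leq_sub2l.
have [_] := mxrank_leqif_sup sub; rewrite rkE => /esym subBA.
apply: trmx_inj; rewrite trmx_mul trmx0; apply/sub_kermxP.
apply: submx_trans subBA; apply/sub_kermxP.
by rewrite -trmx_mul Bx trmx0.
Qed.

Lemma krylov_even (R : comNzRingType) n (S : 'M[R]_n.+1) e (x : 'cV_n.+1) :
  (forall j : 'I_n.+1, odd j -> x j 0 = 0) ->
  exists y, krylov S e *m x = krylov (S ^+ 2) e *m y.
Proof.
move=> x_odd; rewrite krylovE; set p := rVpoly x^T.
have p_odd : odd_poly p = 0.
  apply/polyP => i; rewrite coef_odd_poly coef0 coef_rVpoly.
  case: insubP => // j _ jE; rewrite mxE x_odd //.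
  by rewrite jE /= odd_double.
have sp : (size (even_poly p) <= n.+1)%N.
  apply: leq_trans (size_even_poly p) _; rewrite leq_uphalf_double.
  by apply: leq_trans (size_poly _ _) _; rewrite -addnn leq_addr.
exists (poly_rV (even_poly p))^T.
rewrite krylovE trmxK poly_rV_K // -horner_mx_compXn.
by rewrite -[p in LHS]poly_even_odd p_odd comp_poly0 mul0r addr0.
Qed.

(** Each cross term is even and occurs twice. *)
Lemma sqnorm_sum_mod4 n (v : nat -> 'cV[int]_n) m :
  (forall i j, i != j -> (2 %| ((v i)^T *m v j) 0%R 0%R)%Z) ->
  (4 %| (((\sum_(i < m) v i)^T *m \sum_(i < m) v i) 0 0
          - \sum_(i < m) ((v i)^T *m v i) 0 0)%R)%Z.
Proof.
move=> vv; elim: m => [|m IHm].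
  by rewrite !big_ord0 mulmx0 mxE subrr dvdz0.
rewrite !big_ord_recr /=; set A := \sum_(i < m) _ in IHm *.
set q := \sum_(i < m) _ in IHm *.
have -> : ((A + v m)^T *m (A + v m)) 0 0 - (q + ((v m)^T *m v m) 0 0)
    = ((A^T *m A) 0 0 - q) + 2%:R * (A^T *m v m) 0 0.
  have -> : (A + v m)^T = A^T + (v m)^T by rewrite linearD.
  rewrite mulmxDl !mulmxDr.
  have -> : (v m)^T *m A = A^T *m v m.
    by rewrite -[LHS]trmxK trmx_mul trmxK [LHS]mx11_scalar [RHS]mx11_scalar mxE.
  by rewrite !mxE /=; ring.
rewrite rpredD //.
have /dvdzP[c ->] : (2 %| ((A^T *m v m) 0 0)%R)%Z.
  rewrite /A linear_sum mulmx_suml summxE rpred_sum // => i _; apply: vv.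
  by rewrite ltn_eqF.
by apply/dvdzP; exists c; rewrite mulrCA mulrA.
Qed.

(** * Self-converse graphs *)

Lemma scalemxI (R : idomainType) m n (c : R) (A B : 'M[R]_(m, n)) :
  c != 0 -> c *: A = c *: B -> A = B.
Proof.
move=> nz_c /matrixP eqAB; apply/matrixP => i j.
by apply: (mulfI nz_c); have := eqAB i j; rewrite !mxE.
Qed.

(* A is N Q for a rational orthogonal Q with Q^T e = e and S Q = Q S'. *)
Definition level_mx n (S S' : 'M[int]_n) (N : int) (A : 'M[int]_n) : Prop :=
  [/\ A^T *m A = (N ^+ 2)%:M, A^T *m ones_col n = N *: ones_col n
    & S *m A = A *m S'].

Local Notation modmx p A := (map_mx (intmul (1 : 'F_p)) A).

Lemma sum_alternating m : \sum_(j < m) (-1) ^+ j = (odd m)%:R :> int.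
Proof.
elim: m => [|m IHm]; first by rewrite big_ord0.
by rewrite big_ord_recr /= IHm -signr_odd; case: (odd m).
Qed.

Lemma F2_sqr (x : 'F_2) : x * x = x.
Proof. by case: x => -[|[|]] //= ?; apply: val_inj. Qed.

Lemma F2_oppr (x : 'F_2) : - x = x.
Proof. by case: x => -[|[|]] //= ?; apply: val_inj. Qed.

Lemma F2_neq0 (x : 'F_2) : (x != 0) = (x == 1).
Proof. by case: x => -[|[|]]. Qed.

Lemma dvdz2E (t : int) : (2 %| t)%Z = (t%:~R == 0 :> 'F_2).
Proof. exact: (dvdz_pcharf (pchar_Fp (isT : prime 2))). Qed.

Lemma modmx2_eq m (A B : 'cV[int]_m) :
  (forall i, (2 %| ((A - B) i 0)%R)%Z) -> modmx 2 A = modmx 2 B.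
Proof.
move=> AB; apply/eqP; rewrite -subr_eq0 -map_mxB; apply/eqP/colP => i.
by rewrite mxE [RHS]mxE; apply/eqP; rewrite -dvdz2E.
Qed.

Lemma dvdz2_mul_pred (t : int) : (2 %| (t * (t - 1))%R)%Z.
Proof. by rewrite dvdz2E rmorphM rmorphB /= mulrBr mulr1 F2_sqr subrr. Qed.

Section SelfConverse.

Variables (n : nat) (S : 'M[int]_n.+1) (s : 'S_n.+1) (d : int).
Variables (E : 'M[int]_n.+1) (a b' : 'cV[int]_n.+1) (a' b : 'rV[int]_n.+1).

Local Notation e := (ones_col n.+1).
Local Notation W := (krylov S e).
Local Notation P := (perm_mx s : 'M[int]_n.+1).
Local Notation D := (altsign_mx int n.+1).

Hypotheses (skS : S^T = - S) (SP : P^T *m S *m P = S^T) (odd_d : ~~ (2 %| d)%Z).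
Hypotheses (bb' : b *m b' = 1%:M) (a'a : a' *m a = 1%:M).
Hypotheses (WE : W *m E = 2%:R *: (1%:M - b' *m b)).
Hypotheses (EW : E *m W = 2%:R *: (1%:M - a *m a')).
Hypotheses (Wa : W *m a = (2%:R * d) *: b') (bW : b *m W = (2%:R * d) *: a').

(** This is the integral matrix 2 d W^-1; modulo a prime dividing d it reduces to [a *m b]. *)
Let H := a *m b + d *: E.

Let nz_2d : 2%:R * d != 0.
Proof.
by rewrite mulf_neq0 //; apply: contraNneq odd_d => ->; rewrite dvdz0.
Qed.

Let WH : W *m H = (2%:R * d)%:M.
Proof.
rewrite mulmxDr mulmxA Wa -scalemxAr WE -scalemxAl scalerA [d * _]mulrC.
by rewrite -scalerDr addrC subrK scalemx1.
Qed.

Let HW : H *m W = (2%:R * d)%:M.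
Proof.
rewrite mulmxDl -mulmxA bW -scalemxAr -scalemxAl EW scalerA [d * _]mulrC.
by rewrite -scalerDr addrC subrK scalemx1.
Qed.

Lemma mulmx_walk_inj m (A B : 'M[int]_(m, n.+1)) : A *m W = B *m W -> A = B.
Proof.
move/(congr1 (mulmx^~ H)); rewrite /= -!mulmxA WH !mul_mx_scalar.
exact: scalemxI.
Qed.

Lemma walk_det_neq0 : \det W != 0.
Proof.
have := congr1 determinant WH; rewrite det_mulmx det_scalar => detE.
apply/eqP => det0; move: detE; rewrite det0 mul0r => /esym/eqP.
by rewrite expf_eq0 (negPf nz_2d) andbF.
Qed.

Lemma perm_mx_ones : P *m e = e.
Proof. by rewrite -row_permE; apply/matrixP => i j; rewrite !mxE. Qed.

Lemma perm_mx_anticomm : P *m S = - (S *m P).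
Proof.
have PPT : P *m P^T = 1%:M by rewrite tr_perm_mx -perm_mxM mulgV perm_mx1.
have := congr1 (mulmx P) SP; rewrite !mulmxA PPT mul1mx skS mulmxN => ->.
by rewrite opprK.
Qed.

Let PW : P *m W = W *m D.
Proof. exact: anticomm_krylov perm_mx_anticomm perm_mx_ones. Qed.

(** P acts on the columns of W by signs, and W is nonsingular. *)
Lemma perm_mx_sqr : P *m P = 1%:M.
Proof.
apply: mulmx_walk_inj; rewrite mul1mx -mulmxA PW mulmxA PW -mulmxA.
by rewrite altsign_mx_sqr mulmx1.
Qed.

Lemma perm_mx_sym : P^T = P.
Proof.
have PTP : P^T *m P = 1%:M by rewrite tr_perm_mx -perm_mxM mulVg perm_mx1.
by rewrite -[LHS]mulmx1 -perm_mx_sqr mulmxA PTP mul1mx.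
Qed.

Let HP : H *m P = D *m H.
Proof.
by apply: mulmx_walk_inj; rewrite -!mulmxA PW HW mulmxA HW scalar_mxC.
Qed.

Lemma odd_prime_dvd_col (p : nat) (u : 'cV[int]_n.+1) :
  prime p -> odd p ->
  (forall k, (p %| ((u^T *m (S ^+ k *m e)) 0 0)%R)%Z) ->
  (p %| ((u^T *m u) 0 0)%R)%Z ->
  forall i, (p %| (u i 0)%R)%Z.
Proof.
move=> p_pr p_odd uS uu.
have pcF : p \in [pchar 'F_p] by apply: pchar_Fp.
have nz2 : (2%:R : 'F_p) != 0.
  rewrite -(dvdn_pcharf pcF) dvdn_prime2 //; apply: contraTneq p_odd => -> //.
suff Mu0 : modmx p u = 0.
  move=> i; rewrite (dvdz_pcharf pcF).
  by have /matrixP/(_ i 0) := Mu0; rewrite !mxE => ->.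
have MS k : modmx p (S ^+ k) = (modmx p S) ^+ k.
  exact: (rmorphXn (map_mx (intr : int -> 'F_p))).
have zS k : (modmx p u)^T *m (modmx p S ^+ k *m modmx p e) = 0.
  rewrite -MS  map_trmx -!map_mxM; apply/matrixP => i j; rewrite !ord1 mxE.
  by rewrite [RHS]mxE; apply/eqP; rewrite -(dvdz_pcharf pcF).
have zz : (modmx p u)^T *m (modmx p u) = 0.
  rewrite  map_trmx -!map_mxM; apply/matrixP => i j; rewrite !ord1 mxE.
  by rewrite [RHS]mxE; apply/eqP; rewrite -(dvdz_pcharf pcF).
have MW : modmx p W = krylov (modmx p S) (modmx p e) by rewrite  map_krylov.
have M2 m1 m2 (A : 'M_(m1, m2)) : modmx p (2%:R *: A) = 2%:R *: modmx p A.
  by rewrite  map_mxZ rmorph_nat.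
have M1 m : modmx p (1%:M : 'M_m) = 1%:M by rewrite  map_mx1.
(* If p does not divide d, then W is invertible mod p and orthogonality to its columns already gives
   u = 0. *)
have [/eqP d0 | nz_d] := boolP ((d%:~R : 'F_p) == 0); last first.
  apply: trmx_inj; rewrite trmx0.
  have : (modmx p u)^T *m modmx p W = 0.
    by apply/rowP => j; rewrite MW mul_krylov zS !mxE.
  move/(congr1 (mulmx^~ (modmx p H))); rewrite mul0mx -mulmxA -map_mxM WH.
  rewrite map_scalar_mx mul_mx_scalar rmorphM rmorph_nat => /eqP.
  by rewrite scaler_eq0 mulf_eq0 (negPf nz2) (negPf nz_d) => /eqP.
apply: (@isotropic_kernel_eq0 _ _ (modmx p S) (modmx p P) (modmx p E)
  (modmx p e) (modmx p a) (modmx p b') _ (modmx p a') (modmx p b)) => //.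
- by rewrite  map_trmx skS map_mxN.
- by rewrite  map_trmx perm_mx_sym.
- by rewrite -map_mxM perm_mx_sqr M1.
- by rewrite -!map_mxM perm_mx_anticomm -map_mxN.
- by rewrite -map_mxM perm_mx_ones.
- by rewrite -map_mxM bb' M1.
- by rewrite -map_mxM a'a M1.
- by rewrite -MW -map_mxM WE -M1 -map_mxM -map_mxB M2.
- by rewrite -MW -map_mxM EW -M1 -map_mxM -map_mxB M2.
- by rewrite -MW -map_mxM Wa map_mxZ rmorphM /= d0 mulr0 scale0r.
- by rewrite -MW -map_mxM bW map_mxZ rmorphM /= d0 mulr0 scale0r.
- have MH : modmx p H = modmx p a *m modmx p b.
    by rewrite  map_mxD map_mxM map_mxZ /= d0 scale0r addr0.
  have MD : modmx p D = altsign_mx 'F_p n.+1.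
    rewrite  map_diag_mx; congr diag_mx; apply/rowP => j.
    by rewrite !mxE rmorphXn rmorphN1.
  by rewrite -MH -MD -!map_mxM HP.
Qed.

(** * Integer vectors fixed by the involution P *)

Lemma perm_mx_mul_col (z : 'cV[int]_n.+1) : P *m z = \col_i z (s i) 0.
Proof. by rewrite -row_permE; apply/colP => i; rewrite !mxE. Qed.

Lemma perm_involutive i : s (s i) = i.
Proof.
have : P *m P *m delta_mx (s (s i)) 0 = delta_mx (s (s i)) 0 :> 'cV[int]_n.+1.
  by rewrite perm_mx_sqr mul1mx.
move/matrixP/(_ i 0); rewrite -mulmxA !perm_mx_mul_col !mxE !eqxx /= andbT.
by case: eqP.
Qed.

(* P = W D W^-1 has the same trace as D, and this trace is 0 or 1. *)
Lemma perm_fixed_unique i j : s i = i -> s j = j -> i = j.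
Proof.
move=> si sj; apply/eqP/negPn/negP => ij.
have trP : \tr P = \tr D.
  apply: (mulfI nz_2d); rewrite -!mxtraceZ -!mul_mx_scalar -{1}WH -HW.
  by rewrite !mulmxA PW mxtrace_mulC mulmxA mxtrace_mulC mulmxA.
have : \tr D <= 1.
  rewrite /mxtrace (eq_bigr (fun j : 'I_n.+1 => (-1) ^+ j)).
    by rewrite sum_alternating; case: odd.
  by move=> k _; rewrite !mxE eqxx mulr1n.
rewrite -trP /mxtrace (bigD1 i) //= (bigD1 j) 1?eq_sym //= !mxE si sj !eqxx.
rewrite addrA leNgt => /negP; apply.
rewrite ltr_wpDr // sumr_ge0 // => k _; rewrite !mxE ler0n //.
Qed.

Let fixv : 'cV[int]_n.+1 := \col_i (s i == i)%:R.

Lemma perm_fixed_decomp (z : 'cV[int]_n.+1) :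
  P *m z = z -> exists y, exists c : int, z = y + P *m y + c *: fixv.
Proof.
move=> Pz; have zs i : z (s i) 0 = z i 0 by rewrite -{2}Pz perm_mx_mul_col mxE.
(* Keep z at the smaller index of each 2-cycle; [P *m y] fills in the other one. *)
pose y : 'cV[int]_n.+1 := \col_i if (i < s i)%N then z i 0 else 0.
(* The default 0 occurs only when s has no fixed point, and then [fixv] is zero. *)
exists y; exists (if [pick i | s i == i] is Some i then z i 0 else 0).
apply/colP => i; rewrite perm_mx_mul_col !mxE perm_involutive zs.
have [si|nsi] := eqVneq (s i) i.
  rewrite si ltnn !add0r mulr1; case: pickP => [k /eqP sk|/(_ i)].
    by rewrite (perm_fixed_unique sk si).
  by rewrite si eqxx.
rewrite mulr0 addr0; case: ltngtP => //; rewrite ?addr0 ?add0r //.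
by move/val_inj/esym/eqP; rewrite (negPf nsi).
Qed.

(** Solved for [fixv], this gives access to [H *m fixv], since e is the first column of W. *)
Lemma ones_fixed_decomp : exists y, e = y + P *m y + fixv.
Proof.
pose y : 'cV[int]_n.+1 := \col_i if (i < s i)%N then 1 else 0.
exists y; apply/colP => i; rewrite perm_mx_mul_col !mxE perm_involutive.
have [si|nsi] := eqVneq (s i) i; first by rewrite si ltnn.
case: ltngtP => //.
by move/val_inj/esym/eqP; rewrite (negPf nsi).
Qed.

Lemma add_altsign_even (x : 'cV[int]_n.+1) :
  exists y, x + D *m x = 2%:R *: y.
Proof.
exists (\col_i if odd i then 0 else x i 0); apply/colP => i.
rewrite mul_diag_mx !mxE -signr_odd; case: odd; rewrite ?mulr0.
  by rewrite mulN1r subrr.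
by rewrite mul1r mulr_natl mulr2n.
Qed.

(** As W H = 2 d, it suffices that H z is even. This holds for z = y + P y, where H z = (1 + D) H y;
    for e, where H e is 2 d times a unit vector; hence for [fixv] and for every fixed z. The
    condition D x = x says that only even powers of S occur in W x. *)
Lemma fixed_walk (z : 'cV[int]_n.+1) :
  P *m z = z -> exists2 x, W *m x = d *: z & D *m x = x.
Proof.
move=> Pz; suff [x Hz] : exists x, H *m z = 2%:R *: x.
  exists x; apply: (@scalemxI _ _ _ 2%:R) => //.
    by rewrite scalemxAr -Hz mulmxA WH mul_scalar_mx scalerA.
  by rewrite scalemxAr -Hz mulmxA -HP -mulmxA Pz.
have sym_even (y : 'cV_n.+1) : exists x, H *m (y + P *m y) = 2%:R *: x.
  rewrite mulmxDr [H *m (P *m y)]mulmxA HP -[D *m H *m y]mulmxA.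
  exact: add_altsign_even.
have [c Hf] : exists x, H *m fixv = 2%:R *: x.
  have [y ey] := ones_fixed_decomp; have [x Hx] := sym_even y.
  have eE : e = W *m delta_mx 0 0.
    by rewrite -colE col_krylov expr0 mul1mx.
  have -> : fixv = e - (y + P *m y) by rewrite ey addrAC subrr add0r.
  exists (d *: delta_mx 0 0 - x); rewrite scalerBr -Hx scalerA mulmxBr eE.
  by rewrite [H *m (W *m _)]mulmxA HW mul_scalar_mx.
have [y [k ->]] := perm_fixed_decomp Pz; have [x Hx] := sym_even y.
exists (x + k *: c); rewrite mulmxDr Hx -scalemxAr Hf scalerDr.
by rewrite !scalerA mulrC.
Qed.

(** * Parity of walk counts and the prime 2 *)

Lemma walk_dot i j : ((S ^+ i *m e)^T *m (S ^+ j *m e)) 0 0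
  = (-1) ^+ i * (e^T *m (S ^+ (i + j) *m e)) 0 0.
Proof.
by rewrite trmx_mul skew_trmxX // -scalemxAr -scalemxAl mxE exprD -!mulmxA.
Qed.

Lemma walk_count_odd l : odd l -> e^T *m (S ^+ l *m e) = 0.
Proof.
move=> l_odd.
have /matrixP skew_c : e^T *m (S ^+ l *m e) = - (e^T *m (S ^+ l *m e)).
  rewrite {1}mulmxA {1}[_ *m e]mx11_scalar -tr_scalar_mx -mx11_scalar.
  rewrite trmx_mul trmx_mul trmxK skew_trmxX // -signr_odd l_odd scaleN1r.
  by rewrite mulNmx mulmxN.
apply/matrixP => i j; have /eqP := skew_c i j.
by rewrite [RHS in _ == RHS]mxE -addr_eq0 -mulr2n mulrn_eq0 [RHS]mxE => /eqP.
Qed.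

(** For even l the count is, up to sign, the squared norm of S^(l/2) e. Since t^2 = t mod 2, it has
    the parity of the count for l/2, and one descends until the exponent is odd. *)
Lemma walk_count_even l : (0 < l)%N -> (2 %| ((e^T *m (S ^+ l *m e)) 0 0)%R)%Z.
Proof.
elim/ltn_ind: l => l IHl l0.
have [l_odd|l_even] := boolP (odd l).
  by rewrite walk_count_odd // mxE dvdz0.
have lE : l = (l./2 + l./2)%N by rewrite addnn even_halfK.
have l2 : (0 < l./2)%N.
  by rewrite half_gt0; case: l l0 l_even {IHl lE} => [|[|]].
have : (2 %| ((e^T *m (S ^+ l./2 *m e)) 0 0)%R)%Z.
  by apply: IHl => //; rewrite {2}lE -[X in (X < _)%N]addn0 ltn_add2l.
have -> : (e^T *m (S ^+ l *m e)) 0 0 =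
    (-1) ^+ l./2 * ((S ^+ l./2 *m e)^T *m (S ^+ l./2 *m e)) 0 0.
  by rewrite walk_dot mulrA -expr2 sqrr_sign mul1r -lE.
move=> even_l; rewrite dvdz_mull //.
rewrite -(rpredBr _ even_l) !mxE -sumrB rpred_sum // => i _.
rewrite !mxE mul1r; move: (\sum_j _) => t.
by rewrite -[X in _ - X]mulr1 -mulrBr; apply: dvdz2_mul_pred.
Qed.

Let cop2d : coprimez 2 d.
Proof.
by rewrite /coprimez /gcdz eqz_nat -[_ == _]/(coprime 2 `|d|) prime_coprime.
Qed.

(** Copying the entry at the smaller index of each cycle turns t into a P-invariant v congruent to
    it mod 2; then W x = d v with d odd. *)
Lemma even_walk_lift (t : 'cV[int]_n.+1) :
  (forall i, (2 %| (t i 0 - t (s i) 0)%R)%Z) ->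
  exists2 x, D *m x = x & forall i, (2 %| ((t - W *m x) i 0)%R)%Z.
Proof.
move=> st.
pose v : 'cV[int]_n.+1 := \col_i t (if (i < s i)%N then i else s i) 0.
have Pv : P *m v = v.
  apply/colP => i; rewrite perm_mx_mul_col !mxE perm_involutive.
  by case: ltngtP => // /val_inj ->.
have [x Wx Dx] := fixed_walk Pv; exists x => // i; rewrite Wx.
have tv : (2 %| (t i 0 - v i 0)%R)%Z by rewrite mxE; case: ifP; rewrite ?subrr.
have d1 : (2 %| (d - 1)%R)%Z.
  by rewrite dvdz2E rmorphB subr_eq0 /= -F2_neq0 -dvdz2E.
have -> : (t - d *: v) i 0 = (t i 0 - v i 0) - (d - 1) * v i 0.
  by rewrite mxE mulrBl mul1r opprB addrA subrK !mxE.
by rewrite rpredB // dvdz_mulr.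
Qed.

Lemma two_dvd_col (u : 'cV[int]_n.+1) :
  (forall k, (2 %| ((u^T *m (S ^+ k *m e)) 0 0)%R)%Z) ->
  (forall k, (4 %| (((S ^+ k *m u)^T *m (S ^+ k *m u)) 0 0)%R)%Z) ->
  forall i, (2 %| (u i 0)%R)%Z.
Proof.
move=> uS uSS.
have u_fix (z : 'cV_n.+1) : P *m z = z -> (2 %| ((u^T *m z) 0 0)%R)%Z.
  move=> Pz; have [x Wx _] := fixed_walk Pz.
  rewrite -(Gauss_dvdzr _ cop2d).
  have -> : d * (u^T *m z) 0 0 = (u^T *m W *m x) 0 0.
    by rewrite -mulmxA Wx -scalemxAr [RHS]mxE.
  by rewrite mxE rpred_sum // => j _; rewrite mul_krylov dvdz_mulr.
(* Pair u with the P-invariant vector [delta_mx i 0 + delta_mx (s i) 0]. *)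
have us i : (2 %| (u i 0 - u (s i) 0)%R)%Z.
  pose z : 'cV[int]_n.+1 := delta_mx i 0 + delta_mx (s i) 0.
  have : (2 %| ((u^T *m z) 0 0)%R)%Z.
    apply: u_fix; apply/colP => j; rewrite perm_mx_mul_col !mxE !eqxx !andbT.
    have -> : (s j == i) = (j == s i).
      by rewrite -{1}[i]perm_involutive (inj_eq perm_inj).
    by rewrite (inj_eq perm_inj) addrC.
  rewrite mulmxDr -!colE !mxE !dvdz2E rmorphD rmorphB /=.
  by rewrite F2_oppr.
have [x Dx xu] := even_walk_lift us.
have x_sign (j : 'I_n.+1) : (-1) ^+ j * x j 0 = x j 0.
  by rewrite -{2}Dx mul_diag_mx !mxE.
have x_odd (j : 'I_n.+1) : odd j -> x j 0 = 0.
  move=> j_odd; have /eqP := x_sign j; rewrite -signr_odd j_odd mulN1r.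
  by rewrite eq_sym -addr_eq0 -mulr2n mulrn_eq0 => /eqP.
pose be : 'cV[int]_n.+1 := \col_i (((u - W *m x) i 0)%R %/ 2)%Z.
have uE : u = W *m x + 2%:R *: be.
  have <- : u - W *m x = 2%:R *: be; last by rewrite addrC subrK.
  by apply/colP => i; rewrite [RHS]mxE [be i 0]mxE mulrC divzK.
(* With g the polynomial of x, w is g(S)^2 e mod 2. The coefficients are squared because the
   diagonal terms of the squared norms of S^k W x, taken mod 4, contain x_j^2. *)
pose w := krylov (S ^+ 2) e *m (\col_j (x j 0 * x j 0)).
have SwE k : (e^T *m (S ^+ k *m w)) 0 0
    = \sum_j (x j 0 * x j 0) * (e^T *m (S ^+ (k + (j + j)) *m e)) 0 0.
  rewrite /w krylov_sum !mulmx_sumr summxE; apply: eq_bigr => j _.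
  rewrite -!scalemxAr !mxE exprD -exprM mul2n -addnn; congr (_ * _).
  by rewrite -mulmxE -mulmxA.
have w4 k : (4 %| ((e^T *m (S ^+ k *m w)) 0 0)%R)%Z.
  have [k_odd|k_even] := boolP (odd k).
    rewrite SwE big1 ?dvdz0 // => j _.
    by rewrite walk_count_odd ?mxE ?mulr0 // oddD addnn odd_double addbF.
  have -> : k = (k./2 + k./2)%N by rewrite addnn even_halfK.
  (* From here [k] is half of the original exponent. *)
  move: k./2 => {k_even} {}k.
  pose v j := x (inord j) 0 *: (S ^+ (k + j) *m e).
  have vdot i j : ((v i)^T *m v j) 0 0 = x (inord i) 0 * x (inord j) 0 *
      ((-1) ^+ (k + i) * (e^T *m (S ^+ (k + i + (k + j)) *m e)) 0 0).
    rewrite /v [(_ *: _)^T]linearZ /= -scalemxAl -scalemxAr scalerA mxE.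
    by rewrite walk_dot.
  have vv i j : i != j -> (2 %| ((v i)^T *m v j) 0%R 0%R)%Z.
    move=> ij; rewrite vdot !dvdz_mull // walk_count_even //.
    by case: i j ij => [|i] [|j] //; rewrite ?addnS ?addSn.
  have := sqnorm_sum_mod4 n.+1 vv.
  have -> : \sum_(j < n.+1) v j = S ^+ k *m (W *m x).
    rewrite krylov_sum mulmx_sumr; apply: eq_bigr => j _.
    by rewrite /v inord_val -scalemxAr exprD -mulmxE mulmxA.
  move=> h4; have := uSS k; rewrite uE mulmxDr -scalemxAr.
  set A := S ^+ k *m _ in h4 *; set B := S ^+ k *m be => h4'.
  (* Replacing u by W x = u - 2 be changes the squared norm by a multiple of 4. *)
  have A4 : (4 %| ((A^T *m A) 0 0)%R)%Z.
    have AB : ((A + 2%:R *: B)^T *m (A + 2%:R *: B)) 0 0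
       = (A^T *m A) 0 0 + 4%:R * ((A^T *m B) 0 0 + (B^T *m B) 0 0).
      have -> : (A + 2%:R *: B)^T = A^T + 2%:R *: B^T.
        by rewrite linearD linearZ.
      have BA : B^T *m A = A^T *m B.
        rewrite -[LHS]trmxK trmx_mul trmxK.
        by rewrite [LHS]mx11_scalar [RHS]mx11_scalar mxE.
      rewrite mulmxDl !mulmxDr -!scalemxAl -!scalemxAr BA scalerA.
      by rewrite !mxE; ring.
    by move: h4'; rewrite AB rpredDr // dvdz_mulr.
  have : (4 %| (\sum_(j < n.+1) ((v j)^T *m v j) 0 0)%R)%Z.
    by rewrite -(rpredBl _ A4).
  have -> : \sum_(j < n.+1) ((v j)^T *m v j) 0 0
      = (-1) ^+ k * (e^T *m (S ^+ (k + k) *m w)) 0 0.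
    rewrite SwE mulr_sumr; apply: eq_bigr => j _.
    (* The sign (-1)^j is absorbed because x_j vanishes for odd j. *)
    rewrite vdot inord_val addnACA exprD -[X in _ = _ * (X * _ * _)]x_sign.
    by ring.
  by move=> /(dvdz_mull ((-1) ^+ k)); rewrite mulrA -expr2 sqrr_sign mul1r.
(* All entries of W^T w are divisible by 4; applying H^T gives 4 | 2 d w_i, with d odd. *)
have w_even i : (2 %| (w i 0)%R)%Z.
  have W4 j : (4 %| ((W^T *m w) j 0)%R)%Z.
    have -> : (W^T *m w) j 0 = (-1) ^+ j * (e^T *m (S ^+ j *m w)) 0 0.
      rewrite -[W^T *m w]trmxK mxE trmx_mul trmxK mul_krylov.
      rewrite -[w^T *m _]trmxK mxE trmx_mul trmxK trmx_mul skew_trmxX //.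
      by rewrite -scalemxAr -!scalemxAl mxE mulmxA.
    by rewrite dvdz_mull.
  have : (4 %| ((H^T *m (W^T *m w)) i 0)%R)%Z.
    by rewrite mxE rpred_sum // => j _; rewrite dvdz_mull.
  rewrite mulmxA -trmx_mul WH tr_scalar_mx mul_scalar_mx mxE -mulrA.
  case/dvdzP => c cE; rewrite -(Gauss_dvdzr _ cop2d); apply/dvdzP; exists c.
  by apply: (@mulfI _ (2%:R : int)); rewrite // cE mulrCA.
have Mw : krylov (modmx 2 S ^+ 2) (modmx 2 e) *m modmx 2 x = 0.
  have -> : modmx 2 x = modmx 2 (\col_j (x j 0 * x j 0)).
    by apply/colP => j; rewrite !mxE rmorphM /= F2_sqr.
  have -> : modmx 2 S ^+ 2 = modmx 2 (S ^+ 2).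
    by rewrite (rmorphXn (map_mx (intmul (1 : 'F_2)))).
  rewrite -map_krylov -map_mxM -/w; apply/colP => i; rewrite mxE [RHS]mxE.
  by apply/eqP; rewrite -dvdz2E.
suff : krylov (modmx 2 S) (modmx 2 e) *m modmx 2 x = 0.
  rewrite -map_krylov -map_mxM -(modmx2_eq xu) => /colP u0 i.
  by rewrite dvdz2E; have := u0 i; rewrite !mxE => ->.
(* P maps S^j e to itself up to sign, so S^j e is P-invariant mod 2 and lies in the span of the
   S^(2i) e. Hence W mod 2 factors through the Krylov matrix of S^2, and the two have the same
   kernel. *)
have /fin_all_exists[y yE] (j : 'I_n.+1) : exists y : 'cV['F_2]_n.+1,
    modmx 2 (S ^+ j *m e) = krylov (modmx 2 S ^+ 2) (modmx 2 e) *m y.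
  have [i|x' Dx' x'S] := @even_walk_lift (S ^+ j *m e).
    have /colP/(_ i) := anticomm_mulX perm_mx_anticomm perm_mx_ones j.
    rewrite perm_mx_mul_col mxE [RHS]mxE => ->.
    rewrite dvdz2E rmorphB rmorphM rmorph_sign /= -signr_odd.
    by case: odd; [rewrite mulN1r F2_oppr subrr | rewrite mul1r subrr].
  have x'_odd (k : 'I_n.+1) : odd k -> modmx 2 x' k 0 = 0.
    move=> k_odd; have /colP/(_ k) := Dx'; rewrite mul_diag_mx !mxE.
    rewrite -signr_odd k_odd mulN1r => /eqP.
    by rewrite eq_sym -addr_eq0 -mulr2n mulrn_eq0 => /eqP ->.
  have [y yE] := krylov_even (modmx 2 S) (modmx 2 e) x'_odd.
  exists y; rewrite -yE -map_krylov -map_mxM.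
  exact: modmx2_eq.
apply: (@kermx_factor_eq _ _ _ _ _ _ (\matrix_(i, j) y j i 0) _ _ _ Mw).
  apply/matrixP => i j; have /colP/(_ i) := yE j.
  rewrite map_mxM rmorphXn /= -col_krylov mxE => ->.
  by rewrite !mxE; apply: eq_bigr => k _; rewrite !mxE.
exact: krylov_sqr_F2.
Qed.

(** From S^k A = A S'^k, the entries of A^T S^k e are those of S'^k e times N, up to sign, and the
    squared norm of S^k applied to a column of A is N^2 times an integer. The square provides the
    divisibility by 4 needed at p = 2. *)
Lemma prime_dvd_level (S' A : 'M[int]_n.+1) (N : int) (p : nat) :
  level_mx S S' N A -> prime p -> (p %| N)%Z -> forall i j, (p %| A i j)%Z.
Proof.
move=> [AA Ae SA] p_pr pN i j.
have SAX k : S ^+ k *m A = A *m S' ^+ k.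
  elim: k => [|k IHk]; first by rewrite !expr0 mul1mx mulmx1.
  by rewrite !exprSr -!mulmxE -mulmxA SA mulmxA IHk -mulmxA.
have colN k : (N %| (((col j A)^T *m (S ^+ k *m e)) 0 0)%R)%Z.
  have -> : ((col j A)^T *m (S ^+ k *m e)) 0 0
      = ((-1) ^+ k *: ((S' ^+ k)^T *m (N *: e))) j 0.
    rewrite -Ae [(S' ^+ k)^T *m _]mulmxA -trmx_mul -SAX trmx_mul skew_trmxX //.
    rewrite -scalemxAr -scalemxAl scalerA -expr2 sqrr_sign scale1r -mulmxA.
    by rewrite tr_col -row_mul mxE.
  by rewrite -scalemxAr !mxE mulrCA dvdz_mulr.
have normN k :
    (N ^+ 2 %| (((S ^+ k *m col j A)^T *m (S ^+ k *m col j A)) 0 0)%R)%Z.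
  have -> : S ^+ k *m col j A = A *m (S' ^+ k *m delta_mx j 0).
    by rewrite colE !mulmxA SAX.
  set c := S' ^+ k *m _.
  rewrite trmx_mul -mulmxA [A^T *m _]mulmxA AA mul_scalar_mx -scalemxAr mxE.
  exact: dvdz_mulr.
have -> : A i j = col j A i 0 by rewrite mxE.
have [p_odd|p_even] := boolP (odd p).
  apply: odd_prime_dvd_col => // [k|]; first exact: dvdz_trans pN (colN k).
  have := normN 0%N; rewrite expr0 mul1mx; apply: dvdz_trans.
  by rewrite expr2 dvdz_mulr.
have p2 : p = 2%N.
  by case: (even_prime p_pr) => // p_odd; rewrite p_odd in p_even.
rewrite p2 in pN *.
apply: two_dvd_col => k; first exact: dvdz_trans pN (colN k).
apply: dvdz_trans (normN k); have /dvdzP[c ->] := pN.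
by rewrite exprMn dvdz_mull.
Qed.

End SelfConverse.

(** * Descent on the level *)

Lemma level_mx_descent n (S S' : 'M[int]_n) N A :
  (forall N A p, level_mx S S' N A -> prime p -> (p %| N)%Z ->
     forall i j, (p %| A i j)%Z) ->
  N != 0 -> level_mx S S' N A -> exists B, level_mx S S' 1 B.
Proof.
move=> dvd_level; move: {2}`|N|%N (leqnn `|N|) => m.
elim: m N A => [|m IHm] N A.
  by rewrite leqn0 absz_eq0 => /eqP->; rewrite eqxx.
move=> le_N nz_N levA; have [N1|N1] := eqVneq `|N|%N 1%N.
  have N2 : N * N = 1.
    by move: N1; case: (intP N) nz_N le_N {levA} => // k _ _ /= [->].
  (* Scaling by [N] also covers N = -1. *)
  case: levA => AA Ae SA; exists (N *: A); split.
  - rewrite [(_ *: _)^T]linearZ /= -scalemxAl -scalemxAr scalerA N2 scale1r AA.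
    by rewrite expr2 N2.
  - by rewrite [(_ *: _)^T]linearZ /= -scalemxAl Ae scalerA N2.
  - by rewrite -scalemxAr SA scalemxAl.
pose p := pdiv `|N|.
have N_gt1 : (1 < `|N|)%N by rewrite ltn_neqAle eq_sym N1 absz_gt0.
have p_pr : prime p by apply: pdiv_prime.
have pN : (p %| N)%Z by rewrite dvdzE pdiv_dvd.
have nz_p : (p : int) != 0 by rewrite eqz_nat -lt0n prime_gt0.
have [M NE] := dvdzP pN.
pose B : 'M[int]_n := \matrix_(i, j) (A i j %/ p)%Z.
have AE : A = (p : int) *: B.
  apply/matrixP => i j; rewrite !mxE mulrC divzK //.
  exact: dvd_level levA p_pr pN i j.
have nz_M : M != 0 by apply: contraNneq nz_N => M0; rewrite NE M0 mul0r.
apply: (IHm M B) => //.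
  rewrite -ltnS (leq_trans _ le_N) // NE abszM.
  by rewrite ltn_Pmulr ?absz_gt0 ?prime_gt1.
case: levA => AA Ae SA; split.
- apply: (@scalemxI _ _ _ ((p : int) * p)); first by rewrite mulf_neq0.
  move: AA; rewrite AE [(_ *: _)^T]linearZ /= -scalemxAl -scalemxAr scalerA.
  move=> ->.
  by rewrite NE exprMn mulrC -expr2 -scale_scalar_mx.
- apply: (@scalemxI _ _ _ (p : int)) => //.
  move: Ae; rewrite AE [(_ *: _)^T]linearZ /= -scalemxAl => ->.
  by rewrite NE scalerA mulrC.
- apply: (@scalemxI _ _ _ (p : int)) => //.
  by move: SA; rewrite AE -scalemxAr -scalemxAl.
Qed.

(** In each column the entries and their squares both sum to 1; as t^2 - t >= 0 on integers, every
    entry is 0 or 1. Orthogonality puts the ones of distinct columns in distinct rows. *)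
Lemma level1_perm_mx n (A : 'M[int]_n) :
  A^T *m A = 1%:M -> A^T *m ones_col n = ones_col n ->
  exists s : 'S_n, A = perm_mx s.
Proof.
move=> AA Ae.
have sumA j : \sum_i A i j = 1.
  have /colP/(_ j) := Ae; rewrite !mxE => <-.
  by apply: eq_bigr => i _; rewrite !mxE mulr1.
have dotA j k : \sum_i A i j * A i k = (j == k)%:R.
  have /matrixP/(_ j k) := AA; rewrite !mxE => <-.
  by apply: eq_bigr => i _; rewrite !mxE.
have sq_ge (t : int) : 0 <= t * t - t.
  rewrite -[X in _ - X]mulr1 -mulrBr; have [t0|t0] := ltrP 0 t.
    by apply: mulr_ge0; [exact: ltW | rewrite subr_ge0 -gtz0_ge1].
  by rewrite mulr_le0 // subr_le0 (le_trans t0).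
have A01 i j : A i j * A i j = A i j.
  have /eqP : \sum_i (A i j * A i j - A i j) = 0.
    by rewrite sumrB dotA eqxx sumA subrr.
  rewrite psumr_eq0 // => /allP/(_ i); rewrite mem_index_enum => /(_ isT).
  by rewrite subr_eq0 => /eqP.
have A0or1 i j : A i j = (A i j != 0)%:R.
  have /eqP := A01 i j; rewrite -subr_eq0 -[X in _ - X]mulr1 -mulrBr mulf_eq0.
  by rewrite subr_eq0 => /orP[]/eqP->.
have /fin_all_exists[f fE] j : exists i, A i j != 0.
  apply/existsP; apply: contraT => /existsPn A0; have /eqP := sumA j.
  by rewrite big1 // => i _; apply/eqP; rewrite -[_ == _]negbK A0.
have f_uniq i j : A i j != 0 -> i = f j.
  move=> nzA; apply/eqP/negPn/negP => ne.
  have := sumA j; rewrite (bigD1 i) //= (bigD1 (f j)) 1?eq_sym //=.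
  rewrite A0or1 nzA A0or1 fE => /eqP; rewrite addrA gt_eqF //.
  by rewrite ltr_wpDr // sumr_ge0 // => k _; rewrite A0or1 ler0n.
have f_inj : injective f.
  move=> j k fjk; apply/eqP/negPn/negP => jk; have := dotA j k.
  rewrite (negPf jk) (bigD1 (f j)) //= A0or1 fE fjk A0or1 fE mulr1 => /eqP.
  rewrite gt_eqF // ltr_wpDr // sumr_ge0 // => i _.
  by rewrite A0or1 [A i k]A0or1 mulr_ge0 ?ler0n.
(* [f] sends a column to the row of its 1, whereas [perm_mx] sends rows to columns; hence the
   inverse. *)
exists ((perm f_inj)^-1)%g; apply/matrixP => i j; rewrite !mxE A0or1.
congr (_%:R); rewrite -(inj_eq (@perm_inj _ (perm f_inj))) permKV permE.
by congr nat_of_bool; apply/idP/eqP => [/f_uniq//|->].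
Qed.

(** * From the two spectra to a rational orthogonal matrix *)

Lemma char_poly_tr (R : comNzRingType) n (A : 'M[R]_n) :
  char_poly A^T = char_poly A.
Proof.
rewrite /char_poly -[RHS]det_tr; congr (\det _).
by rewrite /char_poly_mx linearB /= tr_scalar_mx map_trmx.
Qed.

(** Apply [moments_char_poly] to -S and -S' with the rank one update J = e e^T. As -S is the
    transpose of S, it has the same characteristic polynomial. *)
Lemma generalized_spec_walk_count n (S S' : 'M[int]_n.+1) :
  S^T = - S -> S'^T = - S' -> same_spec S S' ->
  same_spec (Jmx n.+1 - S) (Jmx n.+1 - S') ->
  forall k, (ones_col n.+1)^T *m (S ^+ k *m ones_col n.+1)
          = (ones_col n.+1)^T *m (S' ^+ k *m ones_col n.+1).
Proof.
move=> skS skS' eqS eqJS k.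
have JE : Jmx n.+1 = ones_col n.+1 *m (ones_col n.+1)^T.
  by apply/matrixP => i j; rewrite !mxE big_ord1 !mxE mulr1.
have := @moments_char_poly _ _ (- S) (- S') (ones_col n.+1) (ones_col n.+1)^T.
rewrite -JE ![- _ + Jmx _]addrC -{1}skS -{1}skS' !char_poly_tr.
move=> /(_ eqS eqJS k).
rewrite [(- S) ^+ k]exprNn [(- S') ^+ k]exprNn -signr_odd !mulr_sign.
case: odd; last by rewrite -!mulmxA.
by rewrite !mulmxN !mulNmx -!mulmxA => /oppr_inj.
Qed.

(** Take N = det W' and A = W adj(W'), that is, N W W'^-1. The entries of W^T W and W^T S W are
    signed walk counts, so these matrices agree with those of S'; this gives orthogonality and the
    intertwining relation. *)
Lemma generalized_spec_level n (S S' : 'M[int]_n.+1) :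
  S^T = - S -> S'^T = - S' -> \det (krylov S (ones_col n.+1)) != 0 ->
  same_spec S S' -> same_spec (Jmx n.+1 - S) (Jmx n.+1 - S') ->
  exists N A, N != 0 /\ level_mx S S' N A.
Proof.
move=> skS skS' detW eqS eqJS.
have cE := generalized_spec_walk_count skS skS' eqS eqJS.
set e := ones_col _ in detW cE *.
pose W := krylov S e; pose W' := krylov S' e.
have gramE (T : 'M[int]_n.+1) : T^T = - T -> forall k i j,
    ((krylov T e)^T *m (T ^+ k *m krylov T e)) i j
    = (-1) ^+ i * (e^T *m (T ^+ (i + (k + j)) *m e)) 0 0.
  move=> skT k i j; rewrite -walk_dot // exprD -mulmxE -mulmxA -!col_krylov.
  have -> : T ^+ k *m col j (krylov T e) = col j (T ^+ k *m krylov T e).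
    by rewrite !colE mulmxA.
  by rewrite tr_col !mxE; apply: eq_bigr => l _; rewrite !mxE.
have gram k : W^T *m (S ^+ k *m W) = W'^T *m (S' ^+ k *m W').
  by apply/matrixP => i j; rewrite [LHS](gramE _ skS) [RHS](gramE _ skS') cE.
have WW : W^T *m W = W'^T *m W' by have := gram 0%N; rewrite !expr0 !mul1mx.
have WSW : W^T *m (S *m W) = W'^T *m (S' *m W').
  by have := gram 1%N; rewrite !expr1.
set N := \det W'.
have [A AE] : {A | A = W *m \adj W'} by exists (W *m \adj W').
have nz_N : N != 0.
  have /(congr1 determinant) := WW; rewrite !det_mulmx !det_tr => detE.
  move: detW; apply: contraNneq => N0.
  by rewrite -[_ == 0]orbb -mulf_eq0 detE -/N N0 mul0r.
have nz_N2 : N ^+ 2 != 0 by rewrite expf_neq0.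
have AA : A^T *m A = (N ^+ 2)%:M.
  rewrite AE trmx_mul -mulmxA [W^T *m _]mulmxA WW -mulmxA mul_mx_adj.
  rewrite mul_mx_scalar -scalemxAr -trmx_mul mul_mx_adj tr_scalar_mx.
  by rewrite scale_scalar_mx.
have AAT : A *m A^T = (N ^+ 2)%:M.
  have detA : \det A != 0.
    have /(congr1 determinant) := AA; rewrite det_mulmx det_tr det_scalar => dE.
    apply/eqP => d0; move: dE; rewrite d0 mul0r => /esym/eqP.
    by rewrite expf_eq0 (negPf nz_N2).
  have E1 : A *m A^T *m A = N ^+ 2 *: A by rewrite -mulmxA AA mul_mx_scalar.
  have := congr1 (mulmx^~ (\adj A)) E1.
  rewrite /= -[A *m A^T *m A *m _]mulmxA mul_mx_adj mul_mx_scalar.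
  rewrite -scalemxAl mul_mx_adj scale_scalar_mx mulrC -scale_scalar_mx.
  exact: scalemxI.
(* e is the first column of both W and W'. *)
have Ae : A *m e = N *: e.
  have eE (T : 'M[int]_n.+1) : krylov T e *m delta_mx 0 0 = e.
    by rewrite -colE col_krylov expr0 mul1mx.
  rewrite AE -mulmxA -{1}(eE S') [\adj W' *m _]mulmxA mul_adj_mx mul_scalar_mx.
  by rewrite -scalemxAr eE.
have ASA : A^T *m (S *m A) = N ^+ 2 *: S'.
  rewrite AE trmx_mul -mulmxA [S *m _]mulmxA [W^T *m _]mulmxA WSW -!mulmxA.
  rewrite mul_mx_adj mul_mx_scalar -!scalemxAr [(\adj W')^T *m _]mulmxA.
  by rewrite -trmx_mul mul_mx_adj tr_scalar_mx mul_scalar_mx scalerA -expr2.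
exists N, A; split; first exact: nz_N.
split; first exact: AA.
- apply: (scalemxI nz_N); rewrite scalemxAr -{1}Ae mulmxA AA mul_scalar_mx.
  by rewrite scalerA -expr2.
apply: (scalemxI nz_N2); rewrite -mul_scalar_mx -AAT -!mulmxA ASA -scalemxAr.
by [].
Qed.

Lemma mxpowE n (S : 'M[int]_n.+1) k : mxpow S k = S ^+ k.
Proof. by elim: k => [|k IHk] //=; rewrite IHk exprS. Qed.

Lemma walk_matrix_krylov n (S : 'M[int]_n.+1) :
  walk_matrix S = krylov S (ones_col n.+1).
Proof. by apply/matrixP => i j; rewrite mxE [RHS]mxE mxpowE. Qed.

Theorem theorem1p6 (n : nat) (S : 'M[int]_n) (d : int) :
  (2 <= n)%N ->
  oriented_skew S ->
  self_converse S ->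
  ~~ (2 %| d)%Z ->
  has_SNF (walk_matrix S) (snf_target n d) ->
  DGSS S.
Proof.
case: n S => [|n] S //; rewrite ltnS => n_gt0 [skS _] [s SP] odd_d.
rewrite walk_matrix_krylov => snfW S' [skS' _] eqS eqJS.
have [E [a [b' [a' [b [[bb' a'a] WE EW Wa bW]]]]]] :=
  snf_target_decomp n_gt0 snfW.
have detW : \det (krylov S (ones_col n.+1)) != 0.
  exact: walk_det_neq0 odd_d WE Wa.
have [N [A [nz_N levA]]] := generalized_spec_level skS skS' detW eqS eqJS.
have [|B [BB Be SB]] := level_mx_descent _ nz_N levA.
  move=> N' A' p levA' p_pr pN'.
  exact: (prime_dvd_level skS SP odd_d bb' a'a WE EW Wa bW levA' p_pr pN').
rewrite expr1n in BB; rewrite scale1r in Be.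
have [t BE] := level1_perm_mx BB Be; exists t; rewrite -BE.
by rewrite -mulmxA SB mulmxA BB mul1mx.
Qed.
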